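(* Suppose that the nonempty matrix family $\mathscr A\subseteq\mathbb R^{n\times n}$ is uniformly exponentially stable and that $\mathcal W\subseteq\mathbb R^n$ is nonempty and bounded. Then the set $$\mathcal R:=\bigcap_{\ell\ge1}\operatorname{cl}\Big(\bigcup_{k\ge\ell}\mathcal R_k\Big)$$ is nonempty and compact and satisfies $\mathcal F(\mathcal R)\subseteq\mathcal R$. Moreover, $\mathcal R$ is contained in every nonempty closed set $\mathcal S\subseteq\mathbb R^n$ satisfying $\mathcal F(\mathcal S)\subseteq\mathcal S$.
   Context: For $\mathcal S\subseteq\mathbb R^n$, $\mathcal F(\mathcal S):=\{Ax+w: x\in\mathcal S,\ A\in\mathscr A,\ w\in\mathcal W\}$. The family $\mathscr A$ is uniformly exponentially stable if there exist constants $c\ge1$ and $\rho\in[0,1)$ such that $\|A_{k-1}\cdots A_1A_0\|\le c\rho^k$ for every $k\ge1$ and every $A_0,\dots,A_{k-1}\in\mathscr A$, where $\|\cdot\|$ is a fixed matrix norm induced by a vector norm. For $k\ge1$, $\mathfrak B_k(\mathscr A)$ is the set of tuples $\boldsymbol\Psi_k=(\Psi_{k,0},\dots,\Psi_{k,k})$ generated by $A_0,\dots,A_{k-1}\in\mathscr A$ via $\Psi_{k,k}:=I$ and $\Psi_{k,i}:=A_{k-1}A_{k-2}\cdots A_i$ for $0\le i\le k-1$. The $k$-step disturbance-reachable set from the origin is $$\mathcal R_k:=\Big\{\sum_{i=0}^{k-1}\Psi_{k,i+1}w_i:\ \boldsymbol\Psi_k\in\mathfrak B_k(\mathscr A),\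 w_0,\dots,w_{k-1}\in\mathcal W\Big\}.$$ $\operatorname{cl}$ denotes closure. *)

(* Defs.v *)
From mathcomp Require Export all_boot all_order all_algebra.
From mathcomp Require Export all_classical all_reals all_analysis.
Export numFieldNormedType.Exports.

Set Implicit Arguments.
Unset Strict Implicit.
Unset Printing Implicit Defensive.

Import Order.TTheory GRing.Theory Num.Theory.
Local Open Scope classical_set_scope.
Local Open Scope ring_scope.

(* R^n is the type of column vectors 'cV[R]_n; its library topology is the
   product topology and the library norm `|x| is the max norm. *)

Record vector_norm (R : realType) (n : nat) (N : 'cV[R]_n -> R) : Prop :=
  VectorNorm {
    vector_norm_triangle : forall x y, N (x + y) <= N x + N y;
    vector_norm_homogeneous : forall (a : R) x, N (a *: x) = `|a| * N x;
    vector_norm_definite : forall x, N x = 0 -> x = 0 }.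

(* When N is a norm, the set is nonempty and bounded above (finite dimension),
   so this [sup] is a genuine supremum. *)
Definition induced_norm (R : realType) (n : nat) (N : 'cV[R]_n -> R)
    (A : 'M[R]_n) : R :=
  sup [set N (A *m x) | x in [set x : 'cV[R]_n | N x <= 1]].

(* A_{k-1} *m A_{k-2} *m ... *m A_i, in decreasing order of the indices; it is
   the identity when i = k. *)
Definition transition (R : realType) (n : nat) (A : nat -> 'M[R]_n)
    (k i : nat) : 'M[R]_n :=
  \big[mulmx/1%:M]_(j <- rev (index_iota i k)) A j.

(* A finite sequence A_0, ..., A_{k-1} is encoded, here and below, by a function
   on nat of which only the values at j < k are constrained and used. *)
Definition uniformly_exponentially_stable (R : realType) (n : nat)
    (N : 'cV[R]_n -> R) (AA : set 'M[R]_n) : Prop :=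
  exists c rho : R, [/\ 1 <= c, 0 <= rho, rho < 1 &
    forall (k : nat) (A : nat -> 'M[R]_n), (1 <= k)%N ->
      (forall j : nat, (j < k)%N -> AA (A j)) ->
      induced_norm N (transition A k 0) <= c * rho ^+ k].

Definition set_map (R : realType) (n : nat) (AA : set 'M[R]_n)
    (W : set 'cV[R]_n) (S : set 'cV[R]_n) : set 'cV[R]_n :=
  [set y | exists x A w, [/\ S x, AA A, W w & y = A *m x + w]].

Definition transition_tuples (R : realType) (n : nat) (AA : set 'M[R]_n)
    (k : nat) : set ('I_k.+1 -> 'M[R]_n) :=
  [set Psi | exists2 A : nat -> 'M[R]_n,
     forall j : nat, (j < k)%N -> AA (A j) &
     forall i : 'I_k.+1, Psi i = transition A k i].

(* [lift ord0 i] is the index i + 1 in {0, ..., k}. *)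
Definition reachable_set (R : realType) (n : nat) (AA : set 'M[R]_n)
    (W : set 'cV[R]_n) (k : nat) : set 'cV[R]_n :=
  [set y | exists (Psi : 'I_k.+1 -> 'M[R]_n) (w : 'I_k -> 'cV[R]_n),
     [/\ transition_tuples AA Psi, forall i, W (w i) &
         y = \sum_(i < k) Psi (lift ord0 i) *m w i]].

Definition limit_reachable_set (R : realType) (n : nat) (AA : set 'M[R]_n)
    (W : set 'cV[R]_n) : set 'cV[R]_n :=
  \bigcap_(l in [set l | (1 <= l)%N])
    closure (\bigcup_(k in [set k | (l <= k)%N]) reachable_set AA W k).

(* Main.v *)
Require Import Defs.
From mathcomp Require Import all_boot all_order all_algebra.
From mathcomp Require Import all_classical all_reals all_analysis.
Import Order.TTheory GRing.Theory Num.Theory.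
Import numFieldNormedType.Exports.
Local Open Scope classical_set_scope.
Local Open Scope ring_scope.

(** The [k]-step reachable sets are the images of the origin under [k] steps of
    [x |-> A x + w], with [A] and [w] chosen anew at each step; so a further
    step sends [R_k] into [R_(k+1)] ([reachable_set_step]).  The set studied
    here consists of the limit points of these sets as [k] grows, the upper
    limit of the sequence [R_k].

    Invariance is then a matter of continuity: points of [R_k] near [x], with
    [k] large, are sent to points of [R_(k+1)] near [A x + w].

    Stability enters through the estimate [N (Psi_(k,i) x) <= c rho^(k-i) N x]
    ([stable_transition_le]).  Summed over [i], it is a geometric series that
    bounds all the [R_k] at once ([reachable_sets_bounded]); hence the upper
    limit is closed and bounded, so compact, and it contains every cluster
    point of a sequence [y_k] with [y_k] in [R_k], so it is nonempty.

    For minimality, let [s] be a point of a closed invariant set [S].  Driving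
    the system from [s] instead of the origin, with the same [A_j] and [w_j],
    gives a point of [S] that differs from the given point of [R_k] by
    [Psi_(k,0) s], which tends to [0] uniformly in the choice of the [A_j].
    So every limit point of the [R_k] is a limit of points of [S].

    Stability is expressed in an arbitrary norm [N], while boundedness and the
    topology refer to the max norm, and the induced norm is a supremum which is
    only meaningful once [N] is known to control the max norm.  This is why the
    equivalence of [N] with the max norm is established first, by minimizing
    [N] on the compact unit sphere. *)

Set Implicit Arguments.
Unset Strict Implicit.
Unset Printing Implicit Defensive.

(** * Topology of column vectors *)

Lemma continuous_trmx (K : numFieldType) m n :
  continuous (trmx : 'M[K]_(m, n) -> 'M[K]_(n, m)).
Proof.
move=> A B /= /nbhs_ballP [e e0 sub]; apply/nbhs_ballP; exists e => //= C [_ AC].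
by apply: sub; split=> // i j; rewrite !mxE; exact: AC.
Qed.

Lemma mx_entry_le_norm (K : realFieldType) m n (A : 'M[K]_(m, n)) i j :
  `|A i j| <= `|A|.
Proof.
by rewrite [leRHS]/Num.norm /= mx_normrE; apply/bigmax_geP; right; exists (i, j).
Qed.

Lemma closed_norm_le (R : realType) (V : normedModType R) (M : R) :
  closed [set x : V | `|x| <= M].
Proof.
apply: (@preimage_closed _ _ (fun x : V => `|x|) [set r | r <= M]).
  by move=> x _; exact: norm_continuous.
exact: closed_le.
Qed.

(** The ball is a product of segments; [rV_compact] treats such products for row
    vectors, and transposition carries the result over to columns. *)
Lemma compact_cV_ball (R : realType) n (M : R) :
  compact [set x : 'cV[R]_n | `|x| <= M].
Proof.
have cpt : compact [set x : 'rV[R]_n | forall i, `[- M, M]%classic (x ord0 i)].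
  by apply: (@rV_compact R n (fun=> `[- M, M]%classic)) => i; exact: segment_compact.
have cptT := continuous_compact (continuous_subspaceT (@continuous_trmx R 1 n)) cpt.
apply: subclosed_compact cptT _.
  exact: closed_norm_le.
move=> x /= xM; exists x^T; last by rewrite trmxK.
move=> i /=; rewrite mxE in_itv /= -ler_norml.
exact: le_trans (mx_entry_le_norm _ _ _) xM.
Qed.

(** * Norms on column vectors and induced norms *)

Section VectorNorm.
Variables (R : realType) (n : nat) (N : 'cV[R]_n -> R).
Hypothesis N_norm : vector_norm N.

Lemma vector_norm0 : N 0 = 0.
Proof. by rewrite -(scale0r 0) (vector_norm_homogeneous N_norm) normr0 mul0r. Qed.

Lemma vector_normN x : N (- x) = N x.
Proof.
by rewrite -scaleN1r (vector_norm_homogeneous N_norm) normrN1 mul1r.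
Qed.

Lemma vector_norm_ge0 x : 0 <= N x.
Proof.
have := vector_norm_triangle N_norm x (- x).
by rewrite subrr vector_norm0 vector_normN -mulr2n pmulrn_lge0.
Qed.

Lemma vector_norm_sum I (s : seq I) (F : I -> 'cV[R]_n) :
  N (\sum_(i <- s) F i) <= \sum_(i <- s) N (F i).
Proof.
elim/big_rec2: _ => [|i y x _ h]; first by rewrite vector_norm0.
by apply: le_trans (vector_norm_triangle N_norm _ _) _; rewrite lerD2l.
Qed.

(** [A x] is the combination of the columns of [A] with coefficients [x j].  Taking
    [A] to be the identity gives the easy half of norm equivalence; the general
    form also bounds the set whose supremum is the induced norm of [A]. *)
Lemma vector_norm_mulmx_le (A : 'M[R]_n) x :
  N (A *m x) <= (\sum_j N (col j A)) * `|x|.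
Proof.
have -> : A *m x = \sum_j x j ord0 *: col j A.
  apply/colP => i; rewrite mxE summxE; apply: eq_bigr => j _.
  by rewrite !mxE mulrC ord1.
apply: le_trans (vector_norm_sum _ _) _.
rewrite mulr_suml; apply: ler_sum => j _.
rewrite (vector_norm_homogeneous N_norm) mulrC ler_wpM2l ?vector_norm_ge0 //.
exact: mx_entry_le_norm.
Qed.

Lemma vector_norm_upper : exists2 C : R, 0 < C & forall x, N x <= C * `|x|.
Proof.
(* Adding 1 keeps the constant positive when n = 0. *)
exists (1 + \sum_j N (col j 1%:M)) => [|x].
  by rewrite ltr_pwDl // sumr_ge0 // => j _; exact: vector_norm_ge0.
rewrite -[x in N x]mul1mx; apply: le_trans (vector_norm_mulmx_le _ _) _.
by rewrite ler_wpM2r // lerDr.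
Qed.

Lemma vector_norm_distance x y : `|N x - N y| <= N (x - y).
Proof.
rewrite ler_norml lerBlDr lerNl opprB lerBlDr; apply/andP; split.
  rewrite -(vector_normN (x - y)) opprB.
  by apply: le_trans (vector_norm_triangle N_norm _ _); rewrite subrK.
by apply: le_trans (vector_norm_triangle N_norm _ _); rewrite subrK.
Qed.

Lemma vector_norm_continuous : continuous N.
Proof.
have [C C0 NC] := vector_norm_upper.
move=> x U /= /nbhs_ballP [e e0 sub].
apply/nbhs_ballP; exists (e / C) => [|y]; first exact: divr_gt0.
rewrite -ball_normE /ball_ /= => xy; apply: sub; rewrite /ball /=.
apply: le_lt_trans (vector_norm_distance _ _) _; apply: le_lt_trans (NC _) _.
by rewrite mulrC -ltr_pdivlMr.
Qed.

(** The hard half of norm equivalence: [N] is continuous and nonzero on the compact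
    unit sphere of the max norm, so its minimum there is positive, and
    homogeneity extends the resulting bound to all vectors. *)
Lemma vector_norm_lower : exists2 C : R, 0 < C & forall x, `|x| <= C * N x.
Proof.
pose sphere := [set x : 'cV[R]_n | `|x| = 1].
have normalize x : x != 0 -> sphere (`|x|^-1 *: x).
  by move=> x0; rewrite /sphere /= normrZ normfV normr_id mulVf // normr_eq0.
(* The sphere is empty exactly in dimension 0, where every vector is 0. *)
have [/eqP sphere0|/set0P sphereN0] := boolP (sphere == set0).
  exists 1 => // x; have [->|/normalize] := eqVneq x 0.
    by rewrite normr0 mul1r vector_norm_ge0.
  by rewrite sphere0.
have cpt : compact sphere.
  apply: subclosed_compact (@compact_cV_ball R n 1) _; last by move=> x /= ->.
  apply: (@preimage_closed _ _ (fun x : 'cV[R]_n => `|x|) [set r | r = 1]).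
    by move=> x _; exact: norm_continuous.
  exact: closed_eq.
have [z /set_mem zS zmin] := compact_EVT_min sphereN0 cpt
  (continuous_subspaceT vector_norm_continuous).
have Nz0 : 0 < N z.
  rewrite lt_neqAle vector_norm_ge0 andbT eq_sym; apply/eqP.
  move/(vector_norm_definite N_norm) => z0; move: zS.
  by rewrite /sphere /= z0 normr0 => /esym/eqP; rewrite oner_eq0.
exists (N z)^-1 => [|x]; first by rewrite invr_gt0.
have [->|x0] := eqVneq x 0.
  by rewrite normr0 mulr_ge0 ?invr_ge0 ?vector_norm_ge0.
have := zmin _ (mem_set (normalize _ x0)).
rewrite (vector_norm_homogeneous N_norm) normfV normr_id mulrC.
by rewrite ler_pdivlMr ?normr_gt0 // ler_pdivlMl.
Qed.

(** The vector [x / N x] is one of the competitors in the supremum; the equivalence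
    of norms shows that the competitors are bounded, so the supremum is an upper
    bound. *)
Lemma induced_norm_le (A : 'M[R]_n) x : N (A *m x) <= induced_norm N A * N x.
Proof.
have [C C0 NC] := vector_norm_lower.
have [->|x0] := eqVneq x 0; first by rewrite mulmx0 vector_norm0 mulr0.
have Nx0 : 0 < N x.
  rewrite lt_neqAle vector_norm_ge0 andbT eq_sym; apply: contra_neq x0.
  exact: vector_norm_definite.
rewrite -ler_pdivrMr //.
have -> : N (A *m x) / N x = N (A *m ((N x)^-1 *: x)).
  by rewrite -scalemxAr (vector_norm_homogeneous N_norm) gtr0_norm ?invr_gt0 // mulrC.
apply: ub_le_sup; last first.
  exists ((N x)^-1 *: x) => //=.
  by rewrite (vector_norm_homogeneous N_norm) gtr0_norm ?invr_gt0 // mulVf ?gt_eqF.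
exists ((\sum_j N (col j A)) * C) => _ [y /= Ny <-].
apply: le_trans (vector_norm_mulmx_le _ _) _.
rewrite ler_wpM2l ?sumr_ge0 // => [j _|]; first exact: vector_norm_ge0.
apply: le_trans (NC _) _; rewrite -[leRHS]mulr1 ler_wpM2l //; exact: ltW.
Qed.

End VectorNorm.

(** The max norm is itself a vector norm, so [vector_norm_mulmx_le] makes the map
    Lipschitz. *)
Lemma continuous_mulmx (R : realType) n (A : 'M[R]_n) :
  continuous (fun x : 'cV[R]_n => A *m x).
Proof.
have max_norm : @vector_norm R n (fun x => `|x|).
  by split; [exact: ler_normD | exact: normrZ | exact: normr0_eq0].
pose C := 1 + \sum_j `|col j A|.
have C0 : 0 < C by rewrite ltr_pwDl // sumr_ge0.
move=> x U /= /nbhs_ballP [e e0 sub].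
apply/nbhs_ballP; exists (e / C) => [|y]; first exact: divr_gt0.
rewrite -ball_normE /ball_ /= => xy; apply: sub; rewrite -ball_normE /ball_ /=.
rewrite -mulmxBr; apply: le_lt_trans (vector_norm_mulmx_le max_norm _ _) _.
rewrite ltr_pdivlMr // mulrC in xy; apply: le_lt_trans xy.
by rewrite ler_wpM2r // lerDr.
Qed.

(** * Transition matrices and reachable sets *)

Section Dynamics.
Variables (R : realType) (n : nat).
Implicit Types (A : nat -> 'M[R]_n) (w : nat -> 'cV[R]_n).

Lemma transition_diag A k : transition A k k = 1%:M.
Proof. by rewrite /transition /index_iota subnn big_nil. Qed.

Lemma transition_recl A k i :
  (i <= k)%N -> transition A k.+1 i = A k *m transition A k i.
Proof.
move=> ik; rewrite /transition /index_iota subSn // -addn1 iotaD /= subnKC //.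
by rewrite cats1 rev_rcons big_cons.
Qed.

(** Stability bounds only the products that start at index 0; renumbering the
    matrices turns any product of consecutive ones into such a product. *)
Lemma transition_shift A k i :
  transition A (k + i) i = transition (fun j => A (j + i)%N) k 0.
Proof.
elim: k => [|k IHk]; first by rewrite add0n !transition_diag.
by rewrite addSn !transition_recl ?leq_addl // IHk.
Qed.

(** The state at time [k] of [x_(j+1) = A_j x_j + w_j] started at [x_0 = 0]. *)
Definition forced_response A w k : 'cV[R]_n :=
  \sum_(i < k) transition A k i.+1 *m w i.

Lemma forced_responseS A w k :
  forced_response A w k.+1 = A k *m forced_response A w k + w k.
Proof.
rewrite /forced_response big_ord_recr /= transition_diag mul1mx mulmx_sumr.
by congr (_ + _); apply: eq_bigr => i _; rewrite transition_recl // mulmxA.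
Qed.

Variables (AA : set 'M[R]_n) (W : set 'cV[R]_n).

(** Replaces finite families by sequences, so that different values of [k] can be
    related by induction. *)
Lemma reachable_setP k (y : 'cV[R]_n) : W !=set0 ->
  reachable_set AA W k y <->
  exists A w, [/\ forall j, (j < k)%N -> AA (A j), forall j, W (w j) &
                  y = forced_response A w k].
Proof.
case=> w0 Ww0; split=> [[Psi [w [[A AAA PsiE] Ww ->]]]|[A [w [AAA Ww ->]]]].
  (* Past time k the sequence is filled in with w0, to stay in W. *)
  exists A, (fun j => oapp w w0 (insub j)); split=> // [j|].
    by case: (insub j) => [i|] /=.
  by apply: eq_bigr => i _; rewrite PsiE valK.
by exists (fun i => transition A k i), w; split=> //; exists A.
Qed.

Lemma reachable_set_nonempty k :
  AA !=set0 -> W !=set0 -> reachable_set AA W k !=set0.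
Proof.
move=> [A AAA] W0; have [w Ww] := W0.
exists (forced_response (fun=> A) (fun=> w) k); apply/reachable_setP => //.
by exists (fun=> A), (fun=> w).
Qed.

(** Appending [A] and [w] to the data that produced [x] produces [A x + w]. *)
Lemma reachable_set_step k (A : 'M[R]_n) x (w : 'cV[R]_n) : AA A -> W w ->
  reachable_set AA W k x -> reachable_set AA W k.+1 (A *m x + w).
Proof.
move=> AAA Ww; have W0 : W !=set0 by exists w.
move=> /(reachable_setP _ _ W0)[A' [w' [AAA' Ww' ->]]]; apply/(reachable_setP _ _ W0).
pose Ae j := if (j < k)%N then A' j else A.
pose we j := if (j < k)%N then w' j else w.
have agree m : (m <= k)%N -> forced_response Ae we m = forced_response A' w' m.
  elim: m => [|m IHm] mk; first by rewrite /forced_response !big_ord0.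
  by rewrite !forced_responseS IHm 1?ltnW // /Ae /we mk.
exists Ae, we; split=> [j _|j|].
- by rewrite /Ae; case: ifP => // /AAA'.
- by rewrite /we; case: ifP.
- by rewrite forced_responseS agree // /Ae /we ltnn.
Qed.

End Dynamics.

(** * Consequences of exponential stability *)

Section Stability.
Variables (R : realType) (n : nat) (N : 'cV[R]_n -> R) (AA : set 'M[R]_n).
Variable W : set 'cV[R]_n.
Hypothesis (N_norm : vector_norm N).

(** The hypothesis speaks of products of at least one matrix; the empty product is
    covered because [1 <= c]. *)
Lemma stable_transition_le :
  uniformly_exponentially_stable N AA ->
  exists c rho : R, [/\ 1 <= c, 0 <= rho, rho < 1 &
    forall k i (A : nat -> 'M[R]_n) x,
      (i <= k)%N -> (forall j, (j < k)%N -> AA (A j)) ->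
      N (transition A k i *m x) <= c * rho ^+ (k - i) * N x].
Proof.
move=> [c [rho [c1 rho0 rho1 stab]]]; exists c, rho; split=> // k i A x ik AAA.
rewrite -(subnK ik) transition_shift addnK.
have {}AAA j : (j < k - i)%N -> AA (A (j + i)%N).
  by move=> ji; apply: AAA; rewrite addnC -ltn_subRL.
case: (k - i)%N AAA => [|m] AAA.
  rewrite transition_diag mul1mx expr0 mulr1 ler_peMl //.
  exact: vector_norm_ge0.
apply: le_trans (induced_norm_le N_norm _ _) _.
rewrite ler_wpM2r ?vector_norm_ge0 //; exact: stab.
Qed.

Hypothesis (AA_stable : uniformly_exponentially_stable N AA).

(** The disturbance [w_i] contributes at most [c rho^(k-i-1) N w_i] to the state at
    time [k], and the geometric series sums to at most [1 / (1 - rho)], whatever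
    [k] is. *)
Lemma reachable_sets_bounded : W !=set0 -> bounded_set W ->
  exists M : R, forall k x, reachable_set AA W k x -> `|x| <= M.
Proof.
move=> W0 [B0 [_ WB]].
have {WB} [B B_ge0 WB] : exists2 B : R, 0 <= B & forall w, W w -> `|w| <= B.
  exists (Num.max 0 (B0 + 1)); first by rewrite le_max lexx.
  by move=> w Ww; apply: WB => //; rewrite lt_max ltrDl ltr01 orbT.
have [c [rho [c1 rho0 rho1 stab]]] := stable_transition_le AA_stable.
have [C C0 NC] := vector_norm_upper N_norm.
have [D D0 ND] := vector_norm_lower N_norm.
(* C converts the bound on W into the norm N, and D converts the result back. *)
exists (D * (c * (C * B) / (1 - rho))) => k x.
move=> /(reachable_setP _ _ _ W0)[A [w [AAA Ww ->]]].
apply: le_trans (ND _) _; rewrite ler_pM2l //.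
apply: le_trans (vector_norm_sum N_norm _ _) _.
apply: (@le_trans _ _ (\sum_(i < k) c * (C * B) * rho ^+ (k - i.+1))).
  apply: ler_sum => i _; apply: le_trans (stab _ _ _ _ _ AAA) _ => //.
  rewrite mulrAC ler_wpM2r ?exprn_ge0 // ler_wpM2l ?(le_trans _ c1) //.
  by apply: le_trans (NC _) _; rewrite ler_pM2l // WB.
rewrite -mulr_sumr ler_wpM2l //.
  by rewrite !mulr_ge0 ?(le_trans _ c1) // ltW.
rewrite (reindex_inj rev_ord_inj) /=.
under eq_bigr => i _ do rewrite subnSK // (subKn (ltnW (ltn_ord i))).
rewrite -[leRHS]mul1r ler_pdivlMr ?subr_gt0 // mulrC.
rewrite -opprB mulNr -subrX1 opprB lerBlDr lerDl exprn_ge0 //.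
Qed.

End Stability.

(** * The limit reachable set *)

Section LimitSet.
Variables (R : realType) (n : nat) (N : 'cV[R]_n -> R) (AA : set 'M[R]_n).
Variable W : set 'cV[R]_n.
Hypothesis (N_norm : vector_norm N).
Hypothesis (AA_stable : uniformly_exponentially_stable N AA).

(** By linearity the state reached from [s] is the free evolution of [s] plus the
    forced response, and each step of the trajectory stays in [S]. *)
Lemma invariant_set_trajectory (S : set 'cV[R]_n) s A w k :
  set_map AA W S `<=` S -> S s ->
  (forall j, (j < k)%N -> AA (A j)) -> (forall j, W (w j)) ->
  S (transition A k 0 *m s + forced_response A w k).
Proof.
move=> FS Ss AAA Ww; elim: k AAA => [|k IHk] AAA.
  by rewrite transition_diag mul1mx /forced_response big_ord0 addr0.
apply: FS; exists (transition A k 0 *m s + forced_response A w k), (A k), (w k).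
split=> //; [by apply: IHk => j jk; apply: AAA; exact: ltnW | exact: AAA |].
by rewrite transition_recl // forced_responseS mulmxDr mulmxA addrA.
Qed.

Lemma limit_reachable_set_closed : closed (limit_reachable_set AA W).
Proof. by apply: closed_bigI => l _; exact: closed_closure. Qed.

Lemma limit_reachable_set_invariant :
  set_map AA W (limit_reachable_set AA W) `<=` limit_reachable_set AA W.
Proof.
move=> _ [x [A [w [xR AAA Ww ->]]]] l l1 U.
have cont : {for x, continuous (fun z => A *m z + w)}.
  apply: (@cvgD _ _ _ (nbhs x) _ (fun z => A *m z) (fun=> w)).
    exact: continuous_mulmx.
  exact: cvg_cst.
move=> /cont /(xR l l1) [y [[k lk ky] yU]].
exists (A *m y + w); split=> //; exists k.+1; first exact: leqW.
exact: reachable_set_step.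
Qed.

(** A point of [R_k] and the point of [S] reached from [s] with the same data differ
    by [Psi_(k,0) s], of size at most [D c rho^k N s]. *)
Lemma limit_reachable_set_sub_closed_invariant (S : set 'cV[R]_n) :
  W !=set0 -> S !=set0 -> closed S ->
  set_map AA W S `<=` S -> limit_reachable_set AA W `<=` S.
Proof.
move=> W0 [s Ss] clS FS x xR.
have [c [rho [c1 rho0 rho1 stab]]] := stable_transition_le N_norm AA_stable.
have [D D0 ND] := vector_norm_lower N_norm.
apply: clS => U /nbhs_ballP [e e0 sub].
have e20 : 0 < e / 2 by exact: divr_gt0.
pose K := D * (c * N s).
have [l l1 small] : exists2 l, (1 <= l)%N & forall k, (l <= k)%N -> K * rho ^+ k < e / 2.
  have : (fun k => K * rho ^+ k) @ \oo --> K * 0.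
    by apply: cvgMr; apply: cvg_expr; rewrite ger0_norm.
  rewrite mulr0 => /cvgr_lt /(_ _ e20) [l _ lP].
  by exists l.+1 => // k lk; apply: lP; exact: ltnW.
have [y [[k lk] + xy]] := xR l l1 _ (nbhsx_ballx x (e / 2) e20).
move=> /(reachable_setP _ _ _ W0)[A [w [AAA Ww yE]]].
exists (transition A k 0 *m s + y); split.
  by rewrite yE; exact: invariant_set_trajectory.
apply: sub; move: xy; rewrite -!ball_normE /ball_ /= => xy.
rewrite [e]splitr opprD addrCA addrC.
apply: le_lt_trans (ler_normB _ _) _; apply: ltrD => //.
apply: le_lt_trans (ND _) _; apply: le_lt_trans (small k lk).
rewrite /K -mulrA ler_pM2l //.
apply: le_trans (stab _ _ _ _ _ AAA) _ => //.
by rewrite subn0 mulrAC.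
Qed.

Lemma compact_limit_reachable_set : W !=set0 -> bounded_set W ->
  compact (limit_reachable_set AA W).
Proof.
move=> W0 Wb.
have [M MP] := reachable_sets_bounded N_norm AA_stable W0 Wb.
apply: subclosed_compact limit_reachable_set_closed (@compact_cV_ball _ _ M) _.
apply: (@subset_trans _ (closure (\bigcup_(k in [set k | (1 <= k)%N])
  reachable_set AA W k))); first by move=> x; exact.
rewrite closureE; apply: smallest_sub; first exact: closed_norm_le.
by move=> x [k _]; exact: MP.
Qed.

(** A cluster point of a sequence of reachable points, which exists because all of
    them lie in one compact ball. *)
Lemma limit_reachable_set_nonempty :
  AA !=set0 -> W !=set0 -> bounded_set W -> limit_reachable_set AA W !=set0.
Proof.
move=> AA0 W0 Wb.
have [M MP] := reachable_sets_bounded N_norm AA_stable W0 Wb.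
have [y yR] := choice (fun k => reachable_set_nonempty k AA0 W0).
have yM : (y @ \oo) [set x | `|x| <= M] by exists 0%N => // k _; exact: MP k _ (yR k).
have [p [_ pcl]] := @compact_cV_ball R n M (y @ \oo) _ yM.
exists p => l _ U /(pcl (\bigcup_(k in [set k | (l <= k)%N]) reachable_set AA W k)).
apply; exists l => // k lk; exists k => //; exact: yR.
Qed.

End LimitSet.

Theorem proposition2 (R : realType) (n : nat)
    (N : 'cV[R]_n -> R) (AA : set 'M[R]_n) (W : set 'cV[R]_n)
    (N_norm : vector_norm N)
    (AA_nonempty : AA !=set0)
    (AA_stable : uniformly_exponentially_stable N AA)
    (W_nonempty : W !=set0) (W_bounded : bounded_set W) :
  [/\ limit_reachable_set AA W !=set0,
      compact (limit_reachable_set AA W),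
      set_map AA W (limit_reachable_set AA W) `<=` limit_reachable_set AA W &
      forall S : set 'cV[R]_n, S !=set0 -> closed S ->
        set_map AA W S `<=` S -> limit_reachable_set AA W `<=` S].
Proof.
split.
- exact: limit_reachable_set_nonempty N_norm AA_stable AA_nonempty W_nonempty _.
- exact: compact_limit_reachable_set N_norm AA_stable W_nonempty W_bounded.
- exact: limit_reachable_set_invariant.
- move=> S S0 clS FS.
  exact: (limit_reachable_set_sub_closed_invariant N_norm AA_stable).
Qed.
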